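(* Let $\{g_\epsilon\}_{\epsilon\in\mathbb{R}}$ be a one-parameter subgroup of $\mathfrak{G}$. Then, after conjugating the subgroup by a suitable element $h\in\mathfrak{G}$ and multiplying its generator by a suitable nonzero constant, the generator $(\theta,\mathbf{v},w,\mathcal{M})$ of the subgroup belongs to one of the following three categories: \begin{itemize} \item (A) $\theta=w=0$ and $\mathcal{M}\mathbf{v}=0$; \item (B) $\theta=0$, $w=1$ and $\mathcal{M}\mathbf{v}=0$; \item (C) $\theta\neq 0$, $w=0$ and $\mathbf{v}=0$. \end{itemize}
   Context: $\mathfrak{G}$ is the group of transformations of space-time $g:\mathbb{R}^n\times\mathbb{R}\to\mathbb{R}^n\times\mathbb{R}$ of the form $g(\mathbf{x},t)=(\Theta\mathcal{R}\mathbf{x}+\mathbf{a},\ \Theta^2t+b)$ with $\Theta>0$, $b\in\mathbb{R}$, $\mathcal{R}\in O(n,\mathbb{R})$, $\mathbf{a}\in\mathbb{R}^n$. A one-parameter subgroup is a (smooth) homomorphism $\epsilon\mapsto g_\epsilon$ from $\mathbb{R}$ to $\mathfrak{G}$, $g_\epsilon(\mathbf{x},t)=(\Theta(\epsilon)\mathcal{R}(\epsilon)\mathbf{x}+\mathbf{a}(\epsilon),\Theta(\epsilon)^2t+b(\epsilon))$. Its generator is $(\theta,\mathbf{v},w,\mathcal{M})=\frac{d}{d\epsilon}\big|_{\epsilon=0}(\Theta(\epsilon),\mathbf{a}(\epsilon),b(\epsilon),\mathcal{R}(\epsilon))$, with $\theta,w\in\mathbb{R}$, $\mathbf{v}\in\mathbb{R}^n$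 and $\mathcal{M}$ a real antisymmetric $n\times n$ matrix; equivalently, the orbits of the subgroup are the solutions of $\dot{\mathbf{x}}=(\theta+\mathcal{M})\mathbf{x}+\mathbf{v}$, $\dot t=2\theta t+w$, where the dot is $d/d\epsilon$ and the scalar $\theta$ stands for $\theta$ times the identity. Multiplying the generator by a nonzero constant corresponds to rescaling the parameter $\epsilon$ linearly. *)

(* Defs.v *)
From HB Require Import structures.
From mathcomp Require Import all_boot all_order all_algebra.
From mathcomp Require Import all_classical all_reals all_analysis.

Set Implicit Arguments.
Unset Strict Implicit.
Unset Printing Implicit Defensive.

Import Order.TTheory GRing.Theory Num.Theory.
Import numFieldNormedType.Exports.

Local Open Scope classical_set_scope.
Local Open Scope ring_scope.

(** Elements of the group are represented by their parameters
    [(Theta, Rot, a, b)]; [simil_act] is the transformation of space-time they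
    denote, and [simil_act_inj] shows that the parameters are determined by
    the transformation. *)
Record simil (R : realType) (n : nat) := Simil {
  dil : R;
  rot : 'M[R]_n;
  transl : 'cV[R]_n;
  tshift : R;
  dil_gt0 : 0 < dil;
  rot_orth : rot^T *m rot == 1%:M }.

Definition simil_act (R : realType) (n : nat) (g : simil R n)
    (p : 'cV[R]_n * R) : 'cV[R]_n * R :=
  (dil g *: (rot g *m p.1) + transl g, dil g ^+ 2 * p.2 + tshift g).

Section SimilGroup.
Variables (R : realType) (n : nat).
Implicit Types g h k : simil R n.

HB.instance Definition _ := gen_eqMixin (simil R n).
HB.instance Definition _ := gen_choiceMixin (simil R n).

Lemma simil_eq g h : dil g = dil h -> rot g = rot h ->
  transl g = transl h -> tshift g = tshift h -> g = h.
Proof.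
case: g => d r a b dp rp; case: h => d' r' a' b' dp' rp' /= ed er ea eb.
subst d' r' a' b'; congr Simil; exact: bool_irrelevance.
Qed.

Lemma simil_act_inj : injective (@simil_act R n).
Proof.
move=> g h e.
have ex x t : simil_act g (x, t) = simil_act h (x, t) by rewrite e.
have [ea eb] := ex 0 0.
rewrite !mulmx0 !scaler0 !add0r in ea.
rewrite !mulr0 !add0r in eb.
have [_ ed] := ex 0 1.
move: ed; rewrite !mulr1 eb => /addIr ed.
have {}ed : dil g = dil h.
  apply/eqP; rewrite -(@eqrXn2 _ 2) ?ed//; exact/ltW/dil_gt0.
have er : rot g = rot h.
  apply/matrixP => i j.
  have [ec _] := ex (delta_mx j 0) 0.
  move: ec; rewrite /= ea ed => /addIr /(congr1 (fun v => (dil h)^-1 *: v)).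
  rewrite !scalerA mulVf ?scale1r ?gt_eqF ?dil_gt0 //.
  by rewrite -!colE => /matrixP /(_ i 0); rewrite !mxE.
exact: simil_eq.
Qed.

Fact one_orth : (1%:M : 'M[R]_n)^T *m 1%:M == 1%:M.
Proof. by rewrite trmx1 mul1mx. Qed.

Definition simil_one : simil R n := Simil 0 0 ltr01 one_orth.

Fact mul_orth g h : (rot g *m rot h)^T *m (rot g *m rot h) == 1%:M.
Proof.
rewrite trmx_mul mulmxA -[_ *m _ *m rot g]mulmxA (eqP (rot_orth g)) mulmx1.
exact: rot_orth.
Qed.

Definition simil_mul g h : simil R n :=
  Simil (dil g *: (rot g *m transl h) + transl g)
    (dil g ^+ 2 * tshift h + tshift g)
    (mulr_gt0 (dil_gt0 g) (dil_gt0 h)) (mul_orth g h).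

Fact inv_gt0 g : 0 < (dil g)^-1.
Proof. by rewrite invr_gt0 dil_gt0. Qed.

Fact inv_orth g : ((rot g)^T)^T *m (rot g)^T == 1%:M.
Proof. by rewrite trmxK; apply/eqP/mulmx1C/eqP/rot_orth. Qed.

Definition simil_inv g : simil R n :=
  Simil (- ((dil g)^-1 *: ((rot g)^T *m transl g)))
    (- ((dil g)^-1 ^+ 2 * tshift g)) (inv_gt0 g) (inv_orth g).

Lemma simil_act1 p : simil_act simil_one p = p.
Proof.
case: p => x t.
by rewrite /simil_act /= mul1mx scale1r expr1n mul1r !addr0.
Qed.

Lemma simil_actM g h p :
  simil_act (simil_mul g h) p = simil_act g (simil_act h p).
Proof.
case: p => x t; congr pair => /=.
  by rewrite mulmxDr scalerDr addrA -scalemxAr scalerA mulmxA.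
by rewrite mulrDr addrA exprMn mulrA.
Qed.

Lemma simil_actV g p : simil_act (simil_inv g) (simil_act g p) = p.
Proof.
have dN0 : dil g != 0 by rewrite gt_eqF ?dil_gt0.
case: p => x t; congr pair => /=.
  rewrite mulmxDr scalerDr addrK -scalemxAr scalerA mulVf // scale1r.
  by rewrite mulmxA (eqP (rot_orth g)) mul1mx.
by rewrite mulrDr addrK mulrA -exprMn mulVf // expr1n mul1r.
Qed.

Fact simil_mulA : associative simil_mul.
Proof. by move=> g h k; apply: simil_act_inj; apply/funext => p; rewrite !simil_actM. Qed.

Fact simil_mul1 : left_id simil_one simil_mul.
Proof. by move=> g; apply: simil_act_inj; apply/funext => p; rewrite simil_actM simil_act1. Qed.

Fact simil_mulr1 : right_id simil_one simil_mul.
Proof. by move=> g; apply: simil_act_inj; apply/funext => p; rewrite simil_actM simil_act1. Qed.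

Fact simil_mulV : left_inverse simil_one simil_inv simil_mul.
Proof.
move=> g; apply: simil_act_inj; apply/funext => p.
by rewrite simil_actM simil_actV simil_act1.
Qed.

Fact simil_mulrV : right_inverse simil_one simil_inv simil_mul.
Proof.
move=> g; rewrite -[LHS]simil_mul1 -[X in simil_mul X _](simil_mulV (simil_inv g)).
by rewrite -simil_mulA (simil_mulA (simil_inv g)) simil_mulV simil_mul1 simil_mulV.
Qed.

HB.instance Definition _ := isGroup.Build (simil R n)
  simil_mulA simil_mul1 simil_mulr1 simil_mulV simil_mulrV.

Lemma simil_act_comp g h :
  simil_act (g * h)%g = simil_act g \o simil_act h.
Proof. by apply/funext => p; rewrite /= -simil_actM. Qed.

End SimilGroup.

Definition smooth (R : realType) (V : normedModType R) (f : R -> V) : Prop :=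
  forall (k : nat) (x : R), derivable (derive1n k f) x 1.

Definition one_param_subgroup (R : realType) (n : nat)
    (g : R -> simil R n) : Prop :=
  {morph g : s t / s + t >-> (s * t)%g} /\
  [/\ smooth (fun e => dil (g e)), smooth (fun e => rot (g e)),
      smooth (fun e => transl (g e)) & smooth (fun e => tshift (g e))].

(** The quadruple [(theta, v, w, M)]; the product carries the componentwise
    scaling. *)
Definition generator_type (R : realType) (n : nat) : lmodType R :=
  (R * 'cV[R]_n * R * 'M[R]_n)%type.

Definition generator (R : realType) (n : nat) (g : R -> simil R n) :
    generator_type R n :=
  (derive1 (fun e => dil (g e)) 0, derive1 (fun e => transl (g e)) 0,
   derive1 (fun e => tshift (g e)) 0, derive1 (fun e => rot (g e)) 0).

Definition category_A (R : realType) (n : nat) (x : generator_type R n) : Prop :=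
  let: (theta, v, w, M) := x in [/\ theta = 0, w = 0 & M *m v = 0].

Definition category_B (R : realType) (n : nat) (x : generator_type R n) : Prop :=
  let: (theta, v, w, M) := x in [/\ theta = 0, w = 1 & M *m v = 0].

Definition category_C (R : realType) (n : nat) (x : generator_type R n) : Prop :=
  let: (theta, v, w, M) := x in [/\ theta != 0, w = 0 & v = 0].

(* Main.v *)
Require Import Defs.
From mathcomp Require Import all_boot all_order all_algebra.
From mathcomp Require Import all_classical all_reals all_analysis.
Import Order.TTheory GRing.Theory Num.Theory.
Import numFieldNormedType.Exports.
Local Open Scope ring_scope.

(** Conjugating by the space-time translation [(x, t) |-> (x + y, t + s)] keeps
    [theta] and [M] and replaces [v] by [v - (theta + M) y] and [w] by
    [w - 2 theta s] ([generator_conj]); this rests on the product rule for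
    matrix-valued functions. It remains to choose [y] and [s] by linear
    algebra. Since the rotation part is orthogonal and equals the identity at
    parameter [0], [M] is antisymmetric ([generator_rot_antisym]), hence:
    - if [theta != 0], the matrix [theta + M] is invertible, because
      [u (theta + M) u^T = theta |u|^2] ([antisym_add_scalar_unit]), so one can
      reach [v = 0] and [w = 0], which is category C;
    - if [theta = 0], the image of [M] meets its kernel trivially, so the space
      is their direct sum and some [y] gives [M (v - M y) = 0]
      ([antisym_ker_image]). This is category A when [w = 0], and category B
      after division by [w] otherwise. *)

(** * Antisymmetric matrices over a real field *)

Lemma rV_mul_tr_eq0 (R : realFieldType) n (u : 'rV[R]_n) :
  (u *m u^T == 0) = (u == 0).
Proof.
apply/eqP/eqP => [|->]; last by rewrite mul0mx.
move=> /matrixP /(_ 0 0); rewrite !mxE.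
under eq_bigr do rewrite mxE -expr2.
move=> /eqP; rewrite psumr_eq0 => [/allP u0|i _]; last exact: sqr_ge0.
apply/rowP => i; rewrite mxE; apply/eqP.
by have := u0 i (mem_index_enum i); rewrite /= sqrf_eq0.
Qed.

Section Antisymmetric.
Context {R : realFieldType} {n : nat} (M : 'M[R]_n).
Hypothesis asymM : M^T = - M.

Lemma antisym_form_eq0 (u : 'rV[R]_n) : u *m M *m u^T = 0.
Proof.
(* A 1 x 1 matrix equal to its own opposite vanishes. *)
have trE (A : 'M[R]_1) : A^T = A by apply/matrixP => i j; rewrite !ord1 mxE.
have : u *m M *m u^T = - (u *m M *m u^T).
  by rewrite -[LHS]trE !trmx_mul trmxK asymM mulNmx mulmxN mulmxA.
move=> /matrixP e; apply/matrixP => i j; have := e i j; rewrite !mxE.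
by move=> /eqP; rewrite eq_sym eqNr => /eqP.
Qed.

Lemma antisym_add_scalar_unit (a : R) : a != 0 -> a%:M + M \in unitmx.
Proof.
move=> a0; rewrite -row_free_unit; apply/inj_row_free => u uaM.
apply/eqP; rewrite -rV_mul_tr_eq0; apply/eqP.
have := congr1 (mulmx^~ u^T) uaM.
rewrite mul0mx mulmxDr mulmxDl antisym_form_eq0 addr0 mul_mx_scalar -scalemxAl.
by move/eqP; rewrite scaler_eq0 (negPf a0) => /eqP.
Qed.

(** The image of [M] equals that of [M *m M]: a row in the row space of [M] and
    in its kernel is orthogonal to itself. *)
Lemma antisym_sub_sqr : (M <= M *m M)%MS.
Proof.
have capMker : (M :&: kermx M)%MS = 0.
  apply/eqP/rowV0P => u; rewrite sub_capmx => /andP[/submxP[x ux] /sub_kermxP uM].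
  apply/eqP; rewrite -rV_mul_tr_eq0 {2}ux trmx_mul asymM mulNmx mulmxN mulmxA.
  by rewrite uM mul0mx oppr0.
have := mxrank_mul_ker M M; rewrite capMker mxrank0 addn0 => rkM.
by rewrite -(geq_leqif (mxrank_leqif_sup (submxMl M M))) rkM.
Qed.

Lemma antisym_ker_image (v : 'cV[R]_n) : exists y, M *m (v - M *m y) = 0.
Proof.
have /submxP[x xE] : (v^T *m M <= M *m M)%MS.
  exact: submx_trans (submxMl _ _) antisym_sub_sqr.
exists (- x^T); apply: trmx_inj.
rewrite mulmxN opprK trmx_mul linearD /= trmx_mul trmxK asymM trmx0.
by rewrite !mulmxN mulmxDl mulNmx xE mulmxA subrr oppr0.
Qed.

End Antisymmetric.

(** * Derivatives of matrix-valued functions *)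

Section DeriveMatrix.
Context {R : realFieldType} {V : normedModType R}.

Lemma is_derive_mxP {m n} (A : V -> 'M[R]_(m, n)) t v dA :
  is_derive t v A dA <->
  forall i j, is_derive t v (fun x => A x i j) (dA i j).
Proof.
split=> [dAt i j|dAt].
  have /derivable_mxP Ad : derivable A t v by exact: ex_derive.
  apply: DeriveDef => //.
  by rewrite -(derive_val (is_derive := dAt)) derive_mx ?mxE//; exact: ex_derive.
have Ad : derivable A t v by apply/derivable_mxP => i j; exact: ex_derive.
apply: DeriveDef => //; rewrite derive_mx//; apply/matrixP => i j.
by rewrite mxE derive_val.
Qed.

Lemma is_derive_mulmx {m n p} (A : V -> 'M[R]_(m, n)) (B : V -> 'M[R]_(n, p))
    t v dA dB :
  is_derive t v A dA -> is_derive t v B dB ->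
  is_derive t v (fun x => A x *m B x) (dA *m B t + A t *m dB).
Proof.
move=> /is_derive_mxP dAt /is_derive_mxP dBt; apply/is_derive_mxP => i j.
have -> : (fun x => (A x *m B x) i j) =
    \sum_k ((fun x => A x i k) * (fun x => B x k j)).
  by apply/funext => x; rewrite mxE fct_sumE.
have := is_derive_sum (fun k => is_deriveM (dAt i k) (dBt k j)).
move/is_derive_eq; apply; rewrite !mxE -big_split; apply: eq_bigr => k _ /=.
by rewrite addrC; congr (_ + _); exact: mulrC.
Qed.

Lemma is_derive_scalemx {m n} (f : V -> R) (A : V -> 'M[R]_(m, n)) t v df dA :
  is_derive t v f df -> is_derive t v A dA ->
  is_derive t v (fun x => f x *: A x) (df *: A t + f t *: dA).
Proof.
move=> dft /is_derive_mxP dAt; apply/is_derive_mxP => i j.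
have -> : (fun x => (f x *: A x) i j) = f * (fun x => A x i j).
  by apply/funext => x; rewrite mxE.
apply: is_derive_eq; rewrite !mxE addrC.
by congr (_ + _); exact: mulrC.
Qed.

Lemma is_derive_trmx {m n} (A : V -> 'M[R]_(m, n)) t v dA :
  is_derive t v A dA -> is_derive t v (fun x => (A x)^T) dA^T.
Proof.
move=> /is_derive_mxP dAt; apply/is_derive_mxP => i j; rewrite mxE.
by under eq_fun do rewrite mxE.
Qed.

End DeriveMatrix.

(** * Generators of one-parameter subgroups *)

Lemma smooth_is_derive {R : realType} {V : normedModType R} (f : R -> V) :
  smooth f -> forall x, is_derive x (1 : R) f (derive1 f x).
Proof. by move=> fs x; rewrite derive1E; exact/derivableP/(fs 0%N). Qed.

Section Generator.
Context {R : realType} {n : nat} (g : R -> simil R n).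
Hypothesis hg : one_param_subgroup g.

(** The parameter [0] is sent to the unit, since [g 0] is idempotent. *)
Lemma one_param_subgroup0 : g 0 = 1%g.
Proof.
have [gM _] := hg; have := gM 0 0; rewrite addr0 => /(congr1 (fun k => (g 0)^-1 * k)%g).
by rewrite mulgA mulVg mul1g.
Qed.

(** Obtained by differentiating [rot^T *m rot = 1] at the parameter [0]. *)
Lemma generator_rot_antisym theta v w M :
  generator g = (theta, v, w, M) -> M^T = - M.
Proof.
case=> _ _ _ <-.
have [_ [_ /smooth_is_derive-/(_ 0) dr _ _]] := hg.
have := is_derive_mulmx _ _ _ _ _ _ (is_derive_trmx _ _ _ _ dr) dr.
under eq_fun do rewrite (eqP (rot_orth _)).
rewrite one_param_subgroup0 /= trmx1 mulmx1 mul1mx => d1.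
have := @derive_val _ _ _ _ _ _ _ d1; rewrite derive_cst => /esym/eqP.
by rewrite addr_eq0 => /eqP.
Qed.

(** Translation of space-time by [(y, s)]: dilation factor [1] and identity
    rotation. *)
Definition simil_translation (y : 'cV[R]_n) (s : R) : simil R n :=
  Simil y s ltr01 (one_orth R n).

Lemma simil_translation_conj y s (k : simil R n) :
  let k' := (simil_translation y s * k * (simil_translation y s)^-1)%g in
  [/\ dil k' = dil k, Defs.rot k' = Defs.rot k,
      transl k' = dil k *: (Defs.rot k *m (- y)) + (transl k + y) &
      tshift k' = - s * dil k ^+ 2 + (tshift k + s)].
Proof.
split=> /=.
- by rewrite mul1r invr1 mulr1.
- by rewrite mul1mx trmx1 mulmx1.
- by rewrite !mul1mx mul1r invr1 !scale1r trmx1 mul1mx.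
- by rewrite mul1r !expr1n invr1 expr1n !mul1r mulrC.
Qed.

Lemma generator_conj theta v w M (y : 'cV[R]_n) (s : R) :
  generator g = (theta, v, w, M) ->
  generator (fun e =>
    (simil_translation y s * g e * (simil_translation y s)^-1)%g) =
  (theta, v - (theta%:M + M) *m y, w - 2 * theta * s, M).
Proof.
case=> <- <- <- <-.
have [_ [/smooth_is_derive-/(_ 0) dd /smooth_is_derive-/(_ 0) dr
  /smooth_is_derive-/(_ 0) da /smooth_is_derive-/(_ 0) db]] := hg.
have dcst (V : normedModType R) (a : V) : is_derive (0 : R) (1 : R) (cst a) 0.
  exact: is_derive_cst.
have dil0 : dil (g 0) = 1 by rewrite one_param_subgroup0.
have rot0 : Defs.rot (g 0) = 1%:M by rewrite one_param_subgroup0.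
have [/funext dE /funext rE /funext aE /funext bE] :=
  all_and4 (fun e => simil_translation_conj y s (g e)).
rewrite /generator; congr (_, _, _, _).
- by rewrite dE.
- have dry := is_derive_mulmx _ _ _ _ _ _ dr (dcst _ (- y)).
  have dv := is_deriveD (is_derive_scalemx _ _ _ _ _ _ dd dry)
    (is_deriveD da (dcst _ y)).
  rewrite aE derive1E (derive_val (is_derive := dv)) dil0 rot0 mul1mx mulmx0.
  rewrite !addr0 scale1r mulmxDl mul_scalar_mx.
  by rewrite mulmxN scalerN opprD addrC.
- have dw := is_deriveD (is_deriveZ (- s) (is_deriveX 2 dd))
    (is_deriveD db (dcst _ s)).
  rewrite bE derive1E; apply: etrans (derive_val (is_derive := dw)) _.
  rewrite dil0 expr1n mulr1 addr0 addrC; congr (_ + _).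
  by rewrite scaleNr; congr (- _); exact: mulrC.
- by rewrite rE.
Qed.

End Generator.

Theorem mainTheorem1 (R : realType) (n : nat) (g : R -> simil R n)
    (hg : one_param_subgroup g) :
  exists (h : simil R n) (c : R), c != 0 /\
    let x := c *: generator (fun e => (h * g e * h^-1)%g) in
    [\/ category_A x, category_B x | category_C x].
Proof.
case gE : (generator g) => [[[theta v] w] M].
have asymM := generator_rot_antisym g hg _ _ _ _ gE.
have gconj y s := generator_conj g hg _ _ _ _ y s gE.
have [theta0|theta0] := eqVneq theta 0.
  have [y My] := antisym_ker_image M asymM v.
  have [w0|w0] := eqVneq w 0.
    exists (simil_translation y 0), 1; split; first exact: oner_neq0.
    rewrite scale1r gconj theta0 w0; apply: Or31; split=> //.
      by rewrite mulr0 subr0.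
    by rewrite raddf0 add0r.
  exists (simil_translation y 0), w^-1; split; first by rewrite invr_eq0.
  rewrite gconj theta0 mulr0 subr0 raddf0 add0r; apply: Or32; split.
  - exact: mulr0.
  - exact: mulVf.
  - by rewrite -scalemxAl -scalemxAr My !scaler0.
exists (simil_translation (invmx (theta%:M + M) *m v) (w / (2 * theta))), 1.
split; first exact: oner_neq0.
rewrite scale1r gconj; apply: Or33; split=> //.
  by rewrite mulrC divfK ?subrr// mulf_neq0// pnatr_eq0.
by rewrite mulmxA mulmxV ?mul1mx ?subrr// antisym_add_scalar_unit.
Qed.
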